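(* Let $M$ be a positive integer and, for $i=1,\dots,M$, let $r^{i}\in[0,1)$ and let $p^{i}$ be a probability density on $\mathbb{X}$. Let $X$ be a random finite set with multi-Bernoulli (MB) density $$f(\{\boldsymbol{x}_1,\dots,\boldsymbol{x}_n\})=\Big(\prod_{i=1}^{M}(1-r^{i})\Big)\sum_{1\le i_1\ne\cdots\ne i_n\le M}\ \prod_{k=1}^{n}\frac{r^{i_k}\,p^{i_k}(\boldsymbol{x}_k)}{1-r^{i_k}},$$ where the sum is over all $n$-tuples $(i_1,\dots,i_n)$ of pairwise distinct indices in $\{1,\dots,M\}$ (so $f(X)=0$ if $|X|>M$). Then the cardinality of objects inside the field-of-view $\mathcal{S}$ is distributed according to $$\rho_{\mathcal{S}}(n)=\Big(\prod_{i=1}^{M}(1-r^{i})\Big)\sum_{\mathcal{I}_1\uplus\mathcal{I}_2\uplus\mathcal{I}_3=\{1,\dots,M\}}\delta_n(|\mathcal{I}_1|)\prod_{i\in\mathcal{I}_1}\frac{\langle 1_{\mathcal{S}},r^{i}p^{i}\rangle}{1-r^{i}}\prod_{i\in\mathcal{I}_2}\frac{\langle 1-1_{\mathcal{S}},r^{i}p^{i}\rangle}{1-r^{i}},\qquad n=0,1,2,\dots,$$ where the summation is taken over all ordered triples $(\mathcal{I}_1,\mathcal{I}_2,\mathcal{I}_3)$ of mutually exclusive (possibly empty) index sets whose union is $\{1,\dots,M\}$.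
   Context: $\mathbb{X}$ is the single-object (Euclidean) state space and $\mathbb{X}_{\mathrm p}$ is a subspace of it. The field-of-view (FoV) is a compact subset $\mathcal{S}\subset\mathbb{X}_{\mathrm p}$. For $\boldsymbol{x}\in\mathbb{X}$ write $\boldsymbol{x}_{\mathrm p}=\mathrm{proj}_{\mathbb{X}_{\mathrm p}}\boldsymbol{x}$. The generalized indicator is $1_{\mathcal{S}}(\boldsymbol{x})=1$ if $\boldsymbol{x}_{\mathrm p}\in\mathcal{S}$ and $0$ otherwise. Here $M$ is the number of MB components (the maximum possible object cardinality), $r^{i}$ is the probability that the $i$th object exists, and $p^{i}$ is the state density of the $i$th object if it exists. Notation: $[h(\cdot)]^{A}=\prod_{a\in A}h(a)$ for a finite set $A$, with empty product $1$; $\langle f,g\rangle=\int_{\mathbb{X}} f(\boldsymbol{x})g(\boldsymbol{x})\,\mathrm{d}\boldsymbol{x}$; $\delta_a(b)=1$ if $a=b$ and $0$ otherwise; $\uplus$ denotes disjoint union. FoV cardinality distribution: for a finite set $X\subset\mathbb{X}$, the probability that exactly $n$ objects are inside $\mathcal{S}$ conditioned on $X$ is $$\rho_{\mathcal{S}}(n\,|\,X)=\sum_{X^n\subseteq X,\ |X^n|=n}[1_{\mathcal{S}}(\cdot)]^{X^n}[1-1_{\mathcal{S}}(\cdot)]^{X\setminus X^n}.$$ For an RFS with density $f$, the FoV cardinality distribution is the set integral $\rho_{\mathcal{S}}(n)=\int\rho_{\mathcal{S}}(n\,|\,X)f(X)\,\delta X$, that is $$\rho_{\mathcal{S}}(n)=\sum_{m=n}^{\infty}\frac{1}{m!}\int_{\mathbb{X}^m}\rho_{\mathcal{S}}(n\,|\,\{\boldsymbol{x}_1,\dots,\boldsymbol{x}_m\})\,f(\{\boldsymbol{x}_1,\dots,\boldsymbol{x}_m\})\,\mathrm{d}\boldsymbol{x}_1\cdots\mathrm{d}\boldsymbol{x}_m.$$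 *)

(* Defs.v *)
From HB Require Import structures.
From mathcomp Require Import all_boot all_order all_algebra finmap.
From mathcomp Require Import all_classical all_reals all_analysis.

Set Implicit Arguments.
Unset Strict Implicit.
Unset Printing Implicit Defensive.

Import Order.TTheory GRing.Theory Num.Theory.
Import numFieldNormedType.Exports.

Local Open Scope classical_set_scope.
Local Open Scope ring_scope.

Section sigma_finite_pushforward.
Context d1 d2 (T1 : measurableType d1) (T2 : measurableType d2) (R : realType).
Variables (f : T1 -> T2) (g : T2 -> T1).
Hypotheses (mf : measurable_fun setT f) (mg : measurable_fun setT g).
Hypothesis fK : cancel f g.
Variable mu : {measure set T1 -> \bar R}.
Hypothesis mu_sigma_finite : sigma_finite setT mu.

Let nu := pushforward mu f.

Let nu0 : nu set0 = 0%E. Proof. exact: measure0. Qed.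

Let nu_ge0 A : (0 <= nu A)%E. Proof. exact: measure_ge0. Qed.

Let nu_sigma_additive : semi_sigma_additive nu.
Proof. exact: measure_semi_sigma_additive. Qed.

HB.instance Definition _ := isMeasure.Build _ _ _ nu
  nu0 nu_ge0 nu_sigma_additive.

Let nu_sigma_finite : sigma_finite setT nu.
Proof.
have [F TF Foo] := mu_sigma_finite.
exists (fun n => g @^-1` F n).
  by rewrite -preimage_bigcup -TF preimage_setT.
move=> n; have [mF muF] := Foo n; split.
  by rewrite -[X in measurable X]setTI; exact: mg.
rewrite /nu /pushforward -comp_preimage (_ : g \o f = id) ?preimage_id//.
exact/funext.
Qed.

HB.instance Definition _ := Measure_isSigmaFinite.Build _ _ _ nu
  nu_sigma_finite.

Definition sigma_finite_pushforward :
  {sigma_finite_measure set T2 -> \bar R} := nu.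

End sigma_finite_pushforward.

(* The library's sigma-finiteness instance for products only fires on
   subprobabilities. *)
Lemma sigma_finite_product d1 d2 (T1 : measurableType d1)
    (T2 : measurableType d2) (R : realType)
    (m1 : {sigma_finite_measure set T1 -> \bar R})
    (m2 : {sigma_finite_measure set T2 -> \bar R}) :
  sigma_finite setT (m1 \x m2)%E.
Proof.
have /sigma_finiteP[F [TF ndF Foo]] := sigma_finiteT m1.
have /sigma_finiteP[G [TG ndG Goo]] := sigma_finiteT m2.
exists (fun n => F n `*` G n).
  rewrite -setXTT TF TG predeqE => -[x y]; split.
    move=> [/= [n _ Fnx] [k _ Gky]]; exists (maxn n k) => //; split.
      by move: x Fnx; exact/subsetPset/ndF/leq_maxl.
    by move: y Gky; exact/subsetPset/ndG/leq_maxr.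
  by move=> [n _ []/= ? ?]; split; exists n.
move=> k; have [? ?] := Foo k; have [? ?] := Goo k.
split; first exact: measurableX.
by rewrite product_measure1E// lte_mul_pinfty// ge0_fin_numE.
Qed.

Section tuple_measure.
Context d (T : measurableType d) (R : realType).
Variable mu : {sigma_finite_measure set T -> \bar R}.

Definition tuple_cons n (z : T * n.-tuple T) : n.+1.-tuple T :=
  [tuple of z.1 :: z.2].

Definition tuple_uncons n (t : n.+1.-tuple T) : T * n.-tuple T :=
  (thead t, [tuple of behead t]).

Lemma tuple_consK n : cancel (@tuple_cons n) (@tuple_uncons n).
Proof. by case=> x t; congr pair; apply/val_inj. Qed.

Lemma measurable_tuple_cons n : measurable_fun setT (@tuple_cons n).
Proof.
by apply: measurable_cons; [exact: measurable_fst|exact: measurable_snd].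
Qed.

Lemma measurable_tuple_uncons n : measurable_fun setT (@tuple_uncons n).
Proof.
by apply/measurable_fun_pair; [exact: measurable_tnth|exact: measurable_behead].
Qed.

(* The n-fold product of mu with itself. *)
Fixpoint tuple_measure n : {sigma_finite_measure set (n.-tuple T) -> \bar R} :=
  if n is m.+1 then
    sigma_finite_pushforward (@measurable_tuple_cons m)
      (@measurable_tuple_uncons m) (@tuple_consK m)
      (sigma_finite_product mu (tuple_measure m))
  else \d_([tuple] : 0.-tuple T).

Lemma tuple_measure_box n (A : 'I_n -> set T) :
  (forall i, measurable (A i)) ->
  tuple_measure n [set t | forall i, A i (tnth t i)] =
  (\prod_(i < n) mu (A i))%E.
Proof.
elim: n A => [|n IHn] A mA.
  rewrite big_ord0 /= diracE mem_set//.
  by case.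
rewrite big_ord_recl -IHn => [|i]; last exact: mA.
rewrite /= /sigma_finite_pushforward /pushforward -product_measure1E//; last first.
  rewrite (_ : mkset _ =
      \bigcap_(i in [set` enum 'I_n]) ((@tnth n T ^~ i) @^-1` A (lift ord0 i))).
    apply: fin_bigcap_measurable => // i _; rewrite -[X in measurable X]setTI.
    exact: measurable_tnth.
  apply/seteqP; split => t /= At i; first by move=> _; exact: At.
  by apply: At; rewrite /= mem_enum.
congr (_ _); apply/seteqP; split => -[x t] /=.
  move=> At; split; first exact: (At ord0).
  by move=> i; have := At (lift ord0 i); rewrite tnthS.
move=> [A0 At] i; case: (unliftP ord0 i) => [j ->|->//].
by rewrite tnthS; exact: At.
Qed.

End tuple_measure.

Definition measure_matrix_display : measure_display -> measure_display.
Proof. exact. Qed.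

Section measurable_matrix.
Context d (T : measurableType d).
Variables m n : nat.

Definition matrix_cylinder : set (set 'M[T]_(m, n)) :=
  [set A | exists i j, exists2 B, measurable B &
           A = (fun X : 'M[T]_(m, n) => X i j) @^-1` B].

HB.instance Definition _ := @isMeasurable.Build (measure_matrix_display d)
  'M[T]_(m, n) <<s matrix_cylinder >> (@sigma_algebra0 _ _ _)
  (@sigma_algebraC _ _) (@sigma_algebra_bigcup _ _ _).

Lemma measurable_matrix_entry i j :
  measurable_fun setT (fun X : 'M[T]_(m, n) => X i j).
Proof.
move=> _ B mB; rewrite setTI; apply: sub_sigma_algebra.
by exists i, j, B.
Qed.

End measurable_matrix.

Section lebesgue_rV.
Context (R : realType) (d : nat).

Definition rV_of_tuple (t : d.-tuple (measurableTypeR R)) : 'rV[R]_d :=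
  \row_i tnth t i.

Definition tuple_of_rV (x : 'rV[R]_d) : d.-tuple (measurableTypeR R) :=
  [tuple x ord0 i | i < d].

Lemma rV_of_tupleK : cancel rV_of_tuple tuple_of_rV.
Proof. by move=> t; apply/eq_from_tnth => i; rewrite tnth_mktuple mxE. Qed.

Lemma measurable_rV_of_tuple : measurable_fun setT rV_of_tuple.
Proof.
apply: (@measurability _ _ _ _ _ _ (@matrix_cylinder _ R 1 d)) => //= _ [_ [i [j [B mB ->]]] <-]; rewrite setTI.
rewrite -comp_preimage (_ : _ \o _ = (@tnth d _)^~ j); last first.
  by apply/funext => t /=; rewrite mxE.
rewrite -[X in measurable X]setTI; exact: (@measurable_tnth _ (measurableTypeR R)).
Qed.

Lemma measurable_tuple_of_rV : measurable_fun setT tuple_of_rV.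
Proof.
apply/measurable_fun_tnthP => i.
rewrite (_ : _ \o _ = fun x : 'rV[R]_d => x ord0 i); last first.
  by apply/funext => x /=; rewrite tnth_mktuple.
exact: (@measurable_matrix_entry _ R).
Qed.

Definition lebesgue_rV : {sigma_finite_measure set 'rV[R]_d -> \bar R} :=
  sigma_finite_pushforward measurable_rV_of_tuple measurable_tuple_of_rV
    rV_of_tupleK (sigma_finiteT (tuple_measure (@lebesgue_measure R) d)).

Lemma lebesgue_rV_box (A : 'I_d -> set R) : (forall i, measurable (A i)) ->
  lebesgue_rV [set x | forall i, A i (x ord0 i)] =
  (\prod_(i < d) lebesgue_measure (A i))%E.
Proof.
move=> mA; rewrite -tuple_measure_box//; congr (tuple_measure _ _ _).
by apply/seteqP; split => t /= At i; have := At i; rewrite mxE.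
Qed.

End lebesgue_rV.

Section orthogonal_projection.
Context (R : realType) (k d : nat).

(* A subspace of R^d is given as the row space of U; kermx U^T is its
   orthogonal complement. *)
Definition orth_proj (U : 'M[R]_(k, d)) (x : 'rV[R]_d) : 'rV[R]_d :=
  x *m proj_mx <<U>>%MS (kermx U^T).

Lemma kermx_trP (U : 'M[R]_(k, d)) (x : 'rV[R]_d) :
  reflect (forall y : 'rV[R]_d, (y <= U)%MS -> x *m y^T = 0)
          (x <= kermx U^T)%MS.
Proof.
apply: (iffP sub_kermxP) => [xU y /submxP[D ->]|xU].
  by rewrite trmx_mul mulmxA xU mul0mx.
apply/rowP => i; rewrite mxE [RHS]mxE.
have /matrixP/(_ 0 0) := xU _ (row_sub i U); rewrite !mxE => xU0.
by rewrite -[RHS]xU0; apply: eq_bigr => j _; rewrite !mxE.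
Qed.

Lemma cap_orth (U : 'M[R]_(k, d)) : (<<U>> :&: kermx U^T = 0)%MS.
Proof.
apply/eqP/rowV0Pn => -[v]; rewrite sub_capmx genmxE => /andP[vU /kermx_trP vk].
have /matrixP/(_ 0 0) := vk _ vU; rewrite !mxE => /eqP.
rewrite psumr_eq0 => [/allP v0|i _]; last by rewrite mxE -expr2 sqr_ge0.
apply/negP; rewrite negbK; apply/eqP/rowP => i.
have := v0 i (mem_index_enum _); rewrite mxE -expr2 sqrf_eq0 => /eqP ->.
by rewrite mxE.
Qed.

Lemma orth_proj_sub (U : 'M[R]_(k, d)) x : (orth_proj U x <= U)%MS.
Proof. by rewrite (submx_trans (proj_mx_sub _ _ _))// genmxE. Qed.

Lemma orth_proj_orth (U : 'M[R]_(k, d)) (x y : 'rV[R]_d) :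
  (y <= U)%MS -> (x - orth_proj U x) *m y^T = 0.
Proof.
move=> yU; apply: (kermx_trP _ _ _ y yU).
apply: proj_mx_compl_sub; rewrite submx_full//.
rewrite /row_full eqn_leq rank_leq_row/= mxrank_disjoint_sum ?cap_orth//.
by rewrite mxrank_gen mxrank_ker mxrank_tr subnKC ?rank_leq_col.
Qed.

End orthogonal_projection.

Section field_of_view.
Context (R : realType) (d k : nat).
Variables (Xp : 'M[R]_(k, d)) (S : set 'rV[R]_d).

Definition fov_indic (x : 'rV[R]_d) : R := \1_S (orth_proj Xp x).

Definition fov_card_cond (n : nat) (A : {fset 'rV[R]_d}) : R :=
  \sum_(B <- fpowerset A | #|` B| == n)
    (\prod_(x <- B) fov_indic x) *
    (\prod_(x <- (A `\` B)%fset) (1 - fov_indic x)).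

Definition fov_card_dist (f : {fset 'rV[R]_d} -> R) (n : nat) : \bar R :=
  (\sum_(n <= m <oo)
     ((m`!%:R^-1 : R)%:E *
      \int[tuple_measure (lebesgue_rV R d) m]_x
        (fov_card_cond n [fset y | y in tval x]%fset *
         f [fset y | y in tval x]%fset)%:E))%E.

End field_of_view.

Section densities.
Context (R : realType) (d : nat).

Definition is_pdf (p : 'rV[R]_d -> R) : Prop :=
  [/\ measurable_fun setT p, forall x, 0 <= p x &
      (\int[lebesgue_rV R d]_x (p x)%:E = 1)%E].

Definition inner (g h : 'rV[R]_d -> R) : R :=
  \int[lebesgue_rV R d]_x (g x * h x).

(* f is prescribed on every enumeration x of its argument without repetition;
   t ranges over the tuples of pairwise distinct indices. *)
Definition is_mb_density (M : nat) (r : 'I_M -> R) (p : 'I_M -> 'rV[R]_d -> R)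
    (f : {fset 'rV[R]_d} -> R) : Prop :=
  forall (n : nat) (x : n.-tuple 'rV[R]_d), uniq x ->
    f [fset y | y in tval x]%fset =
    (\prod_(i < M) (1 - r i)) *
    \sum_(t : n.-tuple 'I_M | uniq t)
      \prod_(j < n) (r (tnth t j) * p (tnth t j) (tnth x j) /
                     (1 - r (tnth t j))).

End densities.

(* Main.v *)
Require Import Defs.
From mathcomp Require Import all_boot all_order all_algebra finmap.
From mathcomp Require Import all_classical all_reals all_analysis.
From mathcomp Require Import measurable_realfun lra.

Import Order.TTheory GRing.Theory Num.Theory.
Import numFieldNormedType.Exports.

Local Open Scope classical_set_scope.
Local Open Scope ring_scope.

(* Off the null set of tuples with a repeated point, the integrand of the m-th
   term of the set integral is a sum, over the set J of the n positions inside
   the field of view and over the uniq m-tuples t of indices, of products of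
   functions of one variable.  By Tonelli each product integrates to a product
   of one-object integrals, which depends only on the index sets t(J) and
   t(~J); each pair of disjoint sets with n and m - n elements arises m! times,
   which cancels the factor 1/m!.  Summing over m then removes the constraint
   on the cardinality of t(J) and t(~J). *)

(** * Comparison of integrals of possibly non-measurable functions *)

(** The integral of a nonnegative function is a supremum over the simple functions below it, hence
    monotone even without measurability. This spares a measurability proof for the integrand of the
    set integral. *)
Lemma ge0_le_integral_setT d (T : measurableType d) (R : realType)
    (mu : {measure set T -> \bar R}) (f g : T -> \bar R) :
  (forall x, (0 <= f x)%E) -> (forall x, (f x <= g x)%E) ->
  (\int[mu]_x f x <= \int[mu]_x g x)%E.
Proof.
move=> f0 fg.
have g0 x : (0 <= g x)%E by exact: le_trans (f0 x) (fg x).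
rewrite !ge0_integralTE//; apply: ge_ereal_sup => _ [h hf <-].
apply: ereal_sup_ubound; exists h => // x; exact: le_trans (hf x) (fg x).
Qed.

(* Only g has to be measurable: f lies between g \_ ~` N and g + oo \_ N. *)
Lemma ge0_integral_null_ext d (T : measurableType d) (R : realType)
    (mu : {measure set T -> \bar R}) (N : set T) (f g : T -> \bar R) :
  measurable N -> mu N = 0%E -> measurable_fun setT g ->
  (forall x, (0 <= f x)%E) -> (forall x, (0 <= g x)%E) ->
  (forall x, ~ N x -> f x = g x) ->
  (\int[mu]_x f x = \int[mu]_x g x)%E.
Proof.
move=> mN N0 mg f0 g0 fg.
pose top := (cst +oo%E : T -> \bar R) \_ N.
have top0 x : (0 <= top x)%E.
  by rewrite /top patchE; case: ifP => _; [exact: leey|exact: lexx].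
have mtop : measurable_fun setT top.
  by apply/(measurable_restrictT _ mN); exact: measurable_cst.
have mgt : measurable_fun setT (g \+ top)%E by exact: emeasurable_funD.
have gt0 x : (0 <= (g \+ top)%E x)%E by rewrite adde_ge0.
apply/eqP; rewrite eq_le; apply/andP; split.
- rewrite [leRHS](ge0_negligible_integral mN)//.
  rewrite [leRHS](_ : _ = (\int[mu]_(x in setT `\` N) (g \+ top)%E x)%E); last first.
    apply: eq_integral => x; rewrite inE => -[_ Nx] /=.
    by rewrite /top patchE memNset// adde0.
  rewrite -(ge0_negligible_integral mN)//; apply: ge0_le_integral_setT => // x /=.
  rewrite /top patchE; case: ifPn => [_|/negP xN].
    by rewrite addey ?leey// gt_eqF// (lt_le_trans _ (g0 x)).
  by rewrite adde0 fg// => Nx; apply: xN; rewrite inE.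
- rewrite (ge0_negligible_integral mN)// integral_mkcond.
  apply: ge0_le_integral_setT => x; rewrite patchE; case: ifPn => //.
  by rewrite inE => -[_ /fg ->].
Qed.

(** * The product measure on tuples: Tonelli and repeated points *)

Section tuple_measure_theory.
Context d (T : measurableType d) (R : realType).
Variable mu : {sigma_finite_measure set T -> \bar R}.

(** Induction on [m]: the measure on [m.+1]-tuples is the image under [tuple_cons] of a binary
    product, so a change of variables and Tonelli split off the first factor. *)
Lemma ge0_integral_tuple_prod m (g : 'I_m -> T -> R) :
  (forall j, measurable_fun setT (g j)) -> (forall j x, 0 <= g j x) ->
  (\int[tuple_measure mu m]_x (\prod_(j < m) g j (tnth x j))%:E =
   \prod_(j < m) \int[mu]_x (g j x)%:E)%E.
Proof.
elim: m g => [|m IHm] g mg g0.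
  rewrite big_ord0 /= (_ : (fun _ => _) = cst 1%E); last first.
    by apply/funext => x; rewrite big_ord0.
  by rewrite integral_cst//= diracT mule1.
have mprod n (h : 'I_n -> T -> R) : (forall j, measurable_fun setT (h j)) ->
    measurable_fun setT (fun x : n.-tuple T => \prod_(j < n) h j (tnth x j)).
  move=> mh; apply: measurable_prod => j _.
  by apply: measurableT_comp => //; exact: measurable_tnth.
rewrite /= ge0_integral_pushforward//; last 3 first.
- exact: measurable_tuple_cons.
- by apply/measurable_EFinP; exact: mprod.
- by move=> x _; rewrite lee_fin prodr_ge0.
rewrite preimage_setT fubini_tonelli1; last 2 first.
- apply: measurableT_comp; last exact: measurable_tuple_cons.
  by apply/measurable_EFinP; exact: mprod.
- by move=> x /=; rewrite lee_fin prodr_ge0.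
rewrite big_ord_recl -(IHm (fun j => g (lift ord0 j)))// /fubini_F /=.
(* The integral over the tail moves inside the outer integral, and then [g ord0 x] inside the inner
   one, so that the integrands can be compared pointwise. *)
rewrite -ge0_integralZr//; last 3 first.
- exact/measurable_EFinP.
- by move=> x _; rewrite lee_fin.
- by apply: integral_ge0 => x _; rewrite lee_fin prodr_ge0.
apply: eq_integral => x _; rewrite -ge0_integralZl//; last 3 first.
- by apply/measurable_EFinP; apply: (mprod _ (fun j => g (lift ord0 j))).
- by move=> y _; rewrite lee_fin prodr_ge0.
- by rewrite lee_fin.
apply: eq_integral => y _; rewrite big_ord_recl EFinM; congr (_ * _%:E)%E.
by apply: eq_bigr => j _; rewrite tnthS.
Qed.

Hypothesis measurable_diag : measurable [set z : T * T | z.1 = z.2].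

(** Distinctness is a finite conjunction over pairs of positions, each a preimage of the complement
    of the diagonal. The diagonal is assumed measurable because a product sigma-algebra need not
    contain it in general. *)
Lemma measurable_uniq_tuple m : measurable [set x : m.-tuple T | uniq x].
Proof.
rewrite (_ : mkset _ = \bigcap_(ij in [set ij : 'I_m * 'I_m | ij.1 != ij.2])
    ((fun x : m.-tuple T => (tnth x ij.1, tnth x ij.2)) @^-1`
       ~` [set z : T * T | z.1 = z.2])).
  apply: fin_bigcap_measurable; first exact: finite_finset.
  move=> [i j] _; rewrite -[X in measurable X]setTI.
  apply: measurable_fun_pair => //; try exact: measurable_tnth.
  exact: measurableC.
apply/seteqP; split => x /=.
  move=> /tuple_uniqP x_inj [i j] /= ij xij; move/eqP: ij; apply.
  exact: x_inj.
move=> xP; apply/tuple_uniqP => i j xij; apply/eqP/negPn/negP => ij.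
exact: (xP (i, j)).
Qed.

Hypothesis measurable_singleton : forall x : T, measurable [set x].
Hypothesis mu_singleton : forall x, mu [set x] = 0%E.

(** This set is a box with one side [[set x]]; the other sides may have infinite measure, but
    [0 * +oo = 0]. *)
Lemma tuple_measure_tnth_eq m (i : 'I_m) (x : T) :
  (tuple_measure mu m).-negligible [set t | tnth t i = x].
Proof.
pose A j := if j == i then [set x] else setT.
have mA j : measurable (A j) by rewrite /A; case: ifP.
have nuA : tuple_measure mu m [set t | forall j, A j (tnth t j)] = 0%E.
  by rewrite tuple_measure_box// (bigD1 i)//= {1}/A eqxx mu_singleton mul0e.
exists [set t | forall j, A j (tnth t j)]; split => //; last first.
  by move=> t /= ti j; rewrite /A; case: eqP => // ->.
rewrite (_ : mkset _ = \bigcap_(j in [set: 'I_m]) ((@tnth m T ^~ j) @^-1` A j)).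
  apply: fin_bigcap_measurable => [|j _]; first exact: finite_finset.
  by rewrite -[X in measurable X]setTI; exact: measurable_tnth.
by apply/seteqP; split => t /= At j => [_|]; exact: At.
Qed.

(** Induction on [m], by sections: for a fixed head [x], the bad tails either contain [x], a finite
    union of negligible sets, or repeat a point themselves. *)
Lemma tuple_measure_not_uniq m :
  tuple_measure mu m [set x : m.-tuple T | ~~ uniq x] = 0%E.
Proof.
have mN n : measurable [set x : n.-tuple T | ~~ uniq x].
  rewrite (_ : mkset _ = ~` [set x : n.-tuple T | uniq x]).
    by apply: measurableC; exact: measurable_uniq_tuple.
  by apply/seteqP; split => x /= /negP.
elim: m => [|m IHm].
  by rewrite (_ : mkset _ = set0) ?measure0//; apply/seteqP; split => // -[[]].
rewrite /= /sigma_finite_pushforward /pushforward /= /product_measure1.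
apply: integral0_eq => x _ /=.
have mC : measurable ((@tuple_cons _ T m) @^-1` [set y | ~~ uniq y]).
  rewrite -[X in measurable X]setTI; apply: measurable_tuple_cons => //; exact: mN.
apply: measure_negligible; first exact: measurable_xsection.
rewrite (_ : xsection _ _ = \big[setU/set0]_(i < m) [set t | tnth t i = x] `|`
    [set t : m.-tuple T | ~~ uniq t]).
  apply: negligibleU; last by exists [set t : m.-tuple T | ~~ uniq t]; split => //; exact: mN.
  elim/big_ind: _ => [|A B|i _].
  - exact: negligible_set0.
  - exact: negligibleU.
  - exact: tuple_measure_tnth_eq.
apply/seteqP; split => t; rewrite xsectionE/= negb_and negbK.
  move=> /orP[/tnthP[i ->]|]; last by right.
  by left; rewrite -bigcup_seq; exists i => //=; rewrite mem_index_enum.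
rewrite -bigcup_seq => -[[i _ /= <-]|->]; last by rewrite orbT.
by rewrite mem_tnth.
Qed.

End tuple_measure_theory.

(** * Measurable sets and null sets of row vectors *)

Section rV_measurability.
Context (R : realType) (d : nat).

Lemma measurable_rV_box (A : 'I_d -> set R) : (forall i, measurable (A i)) ->
  measurable [set x : 'rV[R]_d | forall i, A i (x 0 i)].
Proof.
move=> mA; rewrite (_ : mkset _ =
    \bigcap_(i in [set: 'I_d]) ((fun x : 'rV[R]_d => x 0 i) @^-1` A i)).
  apply: fin_bigcap_measurable => [|i _]; first exact: finite_finset.
  by rewrite -[X in measurable X]setTI; exact: (@measurable_matrix_entry _ R).
by apply/seteqP; split => x /= Ax i => [_|]; exact: Ax.
Qed.

(** The sigma-algebra is generated by the coordinates, not by the topology; the link is that an open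
    set is a countable union of boxes with rational corners. *)
Lemma open_measurable_rV (U : set 'rV[R]_d) : open U -> measurable U.
Proof.
move=> oU.
pose box (q : 'rV[rat]_d * 'rV[rat]_d) :=
  [set x : 'rV[R]_d | forall i, `]ratr (q.1 0 i), ratr (q.2 0 i)[%classic (x 0 i)].
have mbox q : measurable (box q).
  by apply: (measurable_rV_box (fun i => `]ratr (q.1 0 i), ratr (q.2 0 i)[%classic)).
(* Boxes that leave [U] are replaced by [set0], so that the union runs over the whole countable type
   of pairs of rational corners. *)
pose F q := if `[< box q `<=` U >] then box q else set0.
rewrite (_ : U = \bigcup_q F q); last first.
  apply/seteqP; split => [x Ux|x [q _]]; last first.
    by rewrite /F; case: asboolP => // + qx; exact.
  have /nbhs_ballP[e /= e0 xeU] := open_nbhs_nbhs (conj oU Ux).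
  (* Corners within [e] of [x] on either side in every coordinate keep the box inside the sup-norm
     ball around [x]. *)
  have /choice[a xa] i : exists q : rat, ratr q \in `](x 0 i - e), (x 0 i)[.
    by apply: rat_in_itvoo; rewrite ltrBlDr ltrDl.
  have /choice[b xb] i : exists q : rat, ratr q \in `](x 0 i), (x 0 i + e)[.
    by apply: rat_in_itvoo; rewrite ltrDl.
  exists (\row_i a i, \row_i b i) => //; rewrite /F; case: asboolP => [_ i|[]].
    rewrite !mxE /= in_itv /=.
    by move: (xa i) (xb i); rewrite !in_itv/= => /andP[_ ->] /andP[->].
  move=> y xy; apply: xeU; split => // i j; rewrite ord1 /ball/= ltr_distlC.
  move: (xa j) (xb j) (xy j); rewrite !mxE /= !in_itv /=.
  move=> /andP[? _] /andP[_ ?] /andP[? ?]; apply/andP; split; lra.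
apply: countable_bigcupT_measurable => [|q]; first exact: countableP.
by rewrite /F; case: asboolP.
Qed.

Lemma compact_measurable_rV (S : set 'rV[R]_d) : compact S -> measurable S.
Proof.
move=> /compact_closed cS; rewrite -(setCK S); apply: measurableC.
apply: open_measurable_rV; apply: closed_openC; apply: cS.
exact: norm_hausdorff.
Qed.

Lemma measurable_rV_diag :
  measurable [set z : 'rV[R]_d * 'rV[R]_d | z.1 = z.2].
Proof.
rewrite (_ : mkset _ = \bigcap_(i in [set: 'I_d])
    ((fun z : 'rV[R]_d * 'rV[R]_d => z.1 0 i == z.2 0 i) @^-1` [set true])).
  apply: fin_bigcap_measurable => [|i _]; first exact: finite_finset.
  rewrite -[X in measurable X]setTI; apply: measurable_fun_eqr => //.
    exact: (measurableT_comp (@measurable_matrix_entry _ R 1 d 0 i) measurable_fst).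
  exact: (measurableT_comp (@measurable_matrix_entry _ R 1 d 0 i) measurable_snd).
apply/seteqP; split => -[x y] /=; first by move=> -> i _; exact/eqP.
by move=> xy; apply/rowP => i; exact/eqP/xy.
Qed.

Lemma measurable_rV_set1 (x : 'rV[R]_d) : measurable [set x].
Proof.
rewrite (_ : [set x] = [set y | forall i, [set x 0 i] (y 0 i)]).
  exact: (measurable_rV_box (fun i => [set x 0 i])).
by apply/seteqP; split => y /=; [move=> -> | move=> yx; exact/rowP].
Qed.

(** One null side suffices, hence [0 < d]: in dimension 0 the only point has mass 1. *)
Lemma lebesgue_rV_set1 (x : 'rV[R]_d) : (0 < d)%N -> lebesgue_rV R d [set x] = 0%E.
Proof.
case: d x => // d' x _.
rewrite (_ : [set x] = [set y | forall i, [set x 0 i] (y 0 i)]); last first.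
  by apply/seteqP; split => y /=; [move=> -> | move=> yx; exact/rowP].
rewrite (lebesgue_rV_box (A := fun i => [set x 0 i]))// big_ord_recl.
by rewrite lebesgue_measure_set1 mul0e.
Qed.

Lemma measurable_fun_rV d' (T : measurableType d') (f : T -> 'rV[R]_d) :
  (forall i, measurable_fun setT (fun t => f t 0 i)) -> measurable_fun setT f.
Proof.
move=> mf; apply: (@measurability _ _ _ _ _ _ (@matrix_cylinder _ R 1 d)) => //=.
move=> _ [_ [i [j [B mB ->]]] <-]; rewrite ord1.
rewrite (_ : _ @^-1` _ = (fun t => f t 0 j) @^-1` B)//; exact: mf.
Qed.

Lemma measurable_fov_indic k (Xp : 'M[R]_(k, d)) (S : set 'rV[R]_d) :
  compact S -> measurable_fun setT (fov_indic Xp S).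
Proof.
move=> /compact_measurable_rV mS.
apply: (@measurableT_comp _ _ _ _ _ _ (\1_S : 'rV[R]_d -> R) _ (orth_proj Xp)).
  exact: measurable_indic.
apply: measurable_fun_rV => i; under eq_fun do rewrite mxE.
apply: measurable_sum => j; apply: measurable_funM => //.
exact: (@measurable_matrix_entry _ R).
Qed.

End rV_measurability.

(** * Sums over subsets, index tuples and triples of index sets *)

Section fov_combinatorics.

(** An enumeration without repetition makes [g] below a cardinality-preserving bijection from sets
    of positions to subsets of the point set; the two products then merge into one over
    positions. *)
Lemma big_fpowerset_tuple (R : comPzRingType) (K : choiceType) (m : nat)
    (x : m.-tuple K) (P : pred nat) (s s' : K -> R) : uniq x ->
  \sum_(B <- fpowerset [fset y | y in tval x]%fset | P #|` B|)
    (\prod_(y <- B) s y) *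
    (\prod_(y <- ([fset y | y in tval x] `\` B)%fset) s' y) =
  \sum_(J : {set 'I_m} | P #|J|)
    \prod_(j < m) (if j \in J then s (tnth x j) else s' (tnth x j)).
Proof.
move=> /tuple_uniqP x_inj.
pose g (J : {set 'I_m}) := [fset tnth x j | j in J]%fset.
have gE J j : (tnth x j \in g J) = (j \in J).
  apply/imfsetP/idP => [[i iJ /x_inj ->]//|jJ]; by exists j.
have g_perm (J : {set 'I_m}) : perm_eq (g J) [seq tnth x j | j <- enum J].
  apply: uniq_perm; rewrite ?fset_uniq ?map_inj_uniq ?enum_uniq// => y.
  apply/imfsetP/mapP => /= -[j jJ ->]; exists j => //; by rewrite mem_enum in jJ *.
have gC_perm (J : {set 'I_m}) :
    perm_eq ([fset y | y in tval x] `\` g J)%fset [seq tnth x j | j <- enum (~: J)].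
  apply: uniq_perm; rewrite ?fset_uniq ?map_inj_uniq ?enum_uniq// => y.
  rewrite in_fsetD; apply/andP/mapP => /= [[yJ]|[j jJ ->]].
    rewrite !inE/= => /tnthP[j yj]; exists j => //.
    by rewrite mem_enum inE -gE -yj.
  by rewrite gE !inE/= mem_tnth; rewrite mem_enum inE in jJ.
have powP : perm_eq (fpowerset [fset y | y in tval x]%fset)
    [seq g J | J <- index_enum {set 'I_m}].
  apply: uniq_perm; rewrite ?fset_uniq//.
    rewrite map_inj_uniq ?index_enum_uniq// => I J IJ.
    by apply/setP => j; rewrite -!gE IJ.
  move=> B; rewrite fpowersetE; apply/idP/mapP => [/fsubsetP BA|[J _ ->]].
    exists [set j | tnth x j \in B]%SET; first exact: mem_index_enum.
    apply/fsetP => y; apply/idP/idP => [yB|/imfsetP[j/= + ->]]; last by rewrite inE.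
    have := BA _ yB; rewrite !inE/= => /tnthP[j yj]; rewrite yj in yB *.
    by rewrite gE inE.
  by apply/fsubsetP => y /imfsetP[j _ ->]; rewrite !inE/= mem_tnth.
rewrite (perm_big _ powP) big_map/=; apply: eq_big => [J|J _].
  by rewrite (perm_size (g_perm J)) size_map -cardE.
rewrite (perm_big _ (g_perm J)) (perm_big _ (gC_perm J)) !big_map !big_enum/=.
rewrite [RHS](bigID (mem J))/=; congr (_ * _).
  by apply: eq_bigr => j ->.
by apply: eq_big => j; rewrite ?inE// => /negbTE ->.
Qed.

Variables (R : comPzRingType) (M : nat) (a b : 'I_M -> R).

(** The coefficient of [z^n] in the product of [a i * z + b i] over [i] in [U]: exactly the objects
    of [U] exist, and [n] of them are in the field of view. *)
Definition card_weight (n : nat) (U : {set 'I_M}) : R :=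
  \sum_(I : {set 'I_M} | (I \subset U) && (#|I| == n))
    (\prod_(i in I) a i) * (\prod_(i in U :\: I) b i).

Lemma card_weight_uniq_tuple (n m : nat) (t : m.-tuple 'I_M) : uniq t ->
  \sum_(J : {set 'I_m} | #|J| == n)
    \prod_(j < m) (if j \in J then a (tnth t j) else b (tnth t j)) =
  card_weight n [set i in t]%SET.
Proof.
move=> /tuple_uniqP t_inj; rewrite /card_weight.
(* Preimage under [t] inverts image under [t] only on subsets of the range of [t], which the
   condition on [I] provides. *)
rewrite (reindex_onto (fun J : {set 'I_m} => tnth t @: J)
  (fun I : {set 'I_M} => [set j | tnth t j \in I]))%SET/=; last first.
  move=> I /andP[/fintype.subsetP It _]; apply/setP => i; apply/imsetP/idP => [[j]|iI].
    by rewrite inE => ? ->.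
  have := It _ iI; rewrite inE => /tnthP[j ij]; exists j => //.
  by rewrite inE -ij.
apply: eq_big => [J|J _].
  rewrite card_imset//.
  have -> : [set tnth t j | j in J]%SET \subset [set i in t]%SET.
    by apply/fintype.subsetP => _ /imsetP[j _ ->]; rewrite inE mem_tnth.
  have -> : [set j | tnth t j \in [set tnth t j | j in J]]%SET = J.
    by apply/setP => j; rewrite inE mem_imset.
  by rewrite eqxx andbT.
rewrite (bigID (mem J))/= big_imset/=; last by move=> ? ? _ _; exact: t_inj.
congr (_ * _); first by apply: eq_bigr => j ->.
have -> : ([set i in t] :\: [set tnth t j | j in J])%SET = (tnth t @: (~: J))%SET.
  apply/setP => i; rewrite !inE; apply/andP/imsetP => [[iJ /tnthP[j ij]]|[j jJ ->]].
    by exists j => //; rewrite inE; apply: contra iJ => jJ; rewrite ij imset_f.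
  by rewrite mem_imset//; split; [rewrite inE in jJ|exact: mem_tnth].
rewrite big_imset/=; last by move=> ? ? _ _; exact: t_inj.
by apply: eq_big => j; rewrite ?inE// => /negbTE ->.
Qed.

(** A repetition-free [m]-tuple with entries in a set of [m] elements exhausts it, so these tuples
    are counted by the falling factorial [m ^_ m]. *)
Lemma card_uniq_tuple_set (m : nat) (U : {set 'I_M}) : #|U| = m ->
  #|[set t : m.-tuple 'I_M | uniq t && ([set i in t]%SET == U)]%SET| = m`!.
Proof.
move=> Um; have <- : #|U| ^_ m = m`! by rewrite Um ffactnn.
rewrite -card_uniq_tuples; apply: eq_card => t.
rewrite !inE andbC; apply: andb_id2r => ut; apply/eqP/allP => [Ut i it|tU].
  by have : i \in U by rewrite -Ut inE.
apply/eqP; rewrite eqEcard Um cardsE (card_uniqP ut) size_tuple leqnn andbT.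
by apply/fintype.subsetP => i; rewrite inE => /tU.
Qed.

(** For fixed [t] the sum over [J] depends only on the set of entries of [t], and each set of size
    [m] has [m!] enumerations. *)
Lemma sum_uniq_tuple (n m : nat) :
  \sum_(J : {set 'I_m} | #|J| == n) \sum_(t : m.-tuple 'I_M | uniq t)
    \prod_(j < m) (if j \in J then a (tnth t j) else b (tnth t j)) =
  (\sum_(U : {set 'I_M} | #|U| == m) card_weight n U) *+ m`!.
Proof.
rewrite exchange_big/=; under eq_bigr do rewrite card_weight_uniq_tuple//.
rewrite (partition_big (fun t : m.-tuple 'I_M => [set i in t]%SET)
  (fun U => #|U| == m))/=; last first.
  by move=> t ut; rewrite cardsE (card_uniqP ut) size_tuple.
rewrite -sumrMnl; apply: eq_bigr => U /eqP Um.
rewrite (eq_bigr (fun=> card_weight n U)); last by move=> t /andP[_ /eqP ->].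
by rewrite sumr_const -(card_uniq_tuple_set _ _ Um) cardsE.
Qed.

(** A triple is determined by the union [U] of its first two sets and by its first set [I]: the
    others are [U :\: I] and [~: U]. *)
Lemma sum_disjoint_triples (n : nat) :
  \sum_(I : {set 'I_M} * {set 'I_M} * {set 'I_M} |
         [&& [disjoint I.1.1 & I.1.2], [disjoint I.1.1 & I.2],
             [disjoint I.1.2 & I.2] &
             I.1.1 :|: I.1.2 :|: I.2 == [set: 'I_M]%SET])
    ((n == #|I.1.1|)%:R * (\prod_(i in I.1.1) a i) * (\prod_(i in I.1.2) b i)) =
  \sum_(U : {set 'I_M}) card_weight n U.
Proof.
rewrite [RHS]pair_big_dep/=.
(* The cardinality condition becomes a conditional summand, to match the Kronecker factor. *)
rewrite [RHS]big_mkcondr/=.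
rewrite (reindex_onto (fun p : {set 'I_M} * {set 'I_M} => (p.2, p.1 :\: p.2, ~: p.1))
  (fun I => (I.1.1 :|: I.1.2, I.1.1)))%SET/=; last first.
  move=> [[I J] K]/= /and4P[/pred0P IJ /pred0P IK /pred0P JK /eqP/setP IJK].
  congr (_, _, _); apply/setP => i.
    by have := IJ i; rewrite !inE/=; case: (i \in I) => //= ->.
  have := IK i; have := JK i; have := IJK i; rewrite !inE/=.
  by case: (i \in I); case: (i \in J); case: (i \in K).
apply: eq_big => [[U I]|[U I] _]/=; last first.
  by rewrite eq_sym; case: eqP => _; rewrite ?mul1r// mul0r mul0r.
apply/idP/idP => [/andP[_ /eqP[UI]]|IU].
  by rewrite -UI finset.subsetUl.
have {}IU i : (i \in I) ==> (i \in U) by apply/implyP; exact: fintype.subsetP.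
rewrite -!setI_eq0 xpair_eqE eqxx andbT -!andbA.
apply/and5P; split; apply/eqP/setP => i; move: (IU i); rewrite !inE;
  by case: (i \in I); case: (i \in U).
Qed.

End fov_combinatorics.

(** * The integral of one term of the set integral *)

Section multi_bernoulli.
Context (R : realType) (d : nat).

Lemma fov_indic_itv k (Xp : 'M[R]_(k, d)) S x : 0 <= fov_indic Xp S x <= 1.
Proof. by rewrite /fov_indic indicE; case: (_ \in _); rewrite ?lexx ler01. Qed.

Lemma fov_card_cond_ge0 k (Xp : 'M[R]_(k, d)) S n A :
  0 <= fov_card_cond Xp S n A.
Proof.
apply: sumr_ge0 => B _; apply: mulr_ge0; apply: prodr_ge0 => x _.
  by have /andP[] := fov_indic_itv k Xp S x.
by have /andP[_] := fov_indic_itv k Xp S x; rewrite subr_ge0.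
Qed.

(** [inner] is a real number, so finiteness is needed to identify it with the extended integral; it
    follows from domination by [p], whose integral is 1. *)
Lemma integral_inner_pdf (s p : 'rV[R]_d -> R) (r : R) : 0 <= r < 1 ->
  is_pdf p -> measurable_fun setT s -> (forall x, 0 <= s x <= 1) ->
  (\int[lebesgue_rV R d]_x (s x * (r * p x / (1 - r)))%:E)%E =
  (inner s (fun x => r * p x) / (1 - r))%:E.
Proof.
move=> /andP[r0 r1] [mp p0 p1] ms s01.
have s0 x : 0 <= s x by have /andP[] := s01 x.
have mrp : measurable_fun setT (fun x => r * p x).
  by apply: measurable_funM => //; exact: measurable_cst.
have mf : measurable_fun setT (fun x => s x * (r * p x)) by exact: measurable_funM.
have f0 x : 0 <= s x * (r * p x) by rewrite !mulr_ge0.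
have fin : (\int[lebesgue_rV R d]_x (s x * (r * p x))%:E)%E \is a fin_num.
  rewrite ge0_fin_numE; last by apply: integral_ge0 => x _; rewrite lee_fin.
  apply: (@le_lt_trans _ _ (\int[lebesgue_rV R d]_x (p x)%:E)%E); last first.
    by rewrite p1 ltry.
  apply: ge0_le_integral_setT => x; rewrite lee_fin//.
  have /andP[_ s1] := s01 x; rewrite mulrA ler_piMl//.
  by rewrite mulr_ile1//; exact: ltW.
under eq_integral => x _.
  rewrite (_ : s x * _ = (1 - r)^-1 * (s x * (r * p x))); last first.
    by rewrite mulrA [LHS]mulrC.
  rewrite EFinM.
  over.
rewrite ge0_integralZl//; last 3 first.
- exact/measurable_EFinP.
- by move=> x _; rewrite lee_fin.
- by rewrite lee_fin invr_ge0 subr_ge0 ltW.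
by rewrite mulrC EFinM /inner /Rintegral fineK// muleC.
Qed.

Context (k : nat) (Xp : 'M[R]_(k, d)) (S : set 'rV[R]_d).
Context (M : nat) (r : 'I_M -> R) (p : 'I_M -> 'rV[R]_d -> R).
Context (f : {fset 'rV[R]_d} -> R).
Hypotheses (d_gt0 : (0 < d)%N) (S_compact : compact S).
Hypothesis hr : forall i, 0 <= r i < 1.
Hypothesis hp : forall i, is_pdf (p i).
Hypothesis hf : is_mb_density r p f.

Let w i y := r i * p i y / (1 - r i).
Let s := fov_indic Xp S.
Let P := \prod_(i < M) (1 - r i).
Let a i := inner s (fun x => r i * p i x) / (1 - r i).
Let b i := inner (fun x => 1 - s x) (fun x => r i * p i x) / (1 - r i).

Let w_ge0 i y : 0 <= w i y.
Proof.
have /andP[r0 r1] := hr i; have [_ p0 _] := hp i.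
by rewrite divr_ge0 ?mulr_ge0// subr_ge0 ltW.
Qed.

Let P_ge0 : 0 <= P.
Proof. by apply: prodr_ge0 => i _; rewrite subr_ge0 ltW//; case/andP: (hr i). Qed.

(** Every finite set is enumerated without repetition by its own elements, so [hf] determines [f]
    everywhere. *)
Lemma mb_density_ge0 A : 0 <= f A.
Proof.
have -> : A = [fset y | y in tval (in_tuple (enum_fset A))]%fset.
  by apply/fsetP => y; rewrite !inE.
rewrite hf ?fset_uniq//; apply: mulr_ge0 => //.
by apply: sumr_ge0 => t _; apply: prodr_ge0 => j _; exact: w_ge0.
Qed.

Lemma mb_integrand_uniq n m (x : m.-tuple 'rV[R]_d) : uniq x ->
  fov_card_cond Xp S n [fset y | y in tval x]%fset * f [fset y | y in tval x]%fset =
  P * \sum_(J : {set 'I_m} | #|J| == n) \sum_(t : m.-tuple 'I_M | uniq t)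
    \prod_(j < m) ((if j \in J then s (tnth x j) else 1 - s (tnth x j)) *
                   w (tnth t j) (tnth x j)).
Proof.
move=> ux; rewrite hf// /fov_card_cond.
rewrite (big_fpowerset_tuple _ _ _ _ (fun c => c == n))// mulrCA; congr (_ * _).
rewrite mulr_suml; apply: eq_bigr => J _.
by rewrite mulr_sumr; apply: eq_bigr => t _; rewrite -big_split.
Qed.

Lemma integral_mb_summand n m :
  (\int[tuple_measure (lebesgue_rV R d) m]_x
     (fov_card_cond Xp S n [fset y | y in tval x]%fset *
      f [fset y | y in tval x]%fset)%:E)%E =
  (P * ((\sum_(U : {set 'I_M} | #|U| == m) card_weight R M a b n U) *+ m`!))%:E.
Proof.
have ms : measurable_fun setT s by exact: measurable_fov_indic.
have ms' : measurable_fun setT (fun x => 1 - s x).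
  by apply: measurable_funB => //; exact: measurable_cst.
have s01 x : 0 <= s x <= 1 by exact: fov_indic_itv.
have s'01 x : 0 <= 1 - s x <= 1.
  by have /andP[? ?] := s01 x; rewrite subr_ge0 gerBl; apply/andP.
pose h (J : {set 'I_m}) (t : m.-tuple 'I_M) j y :=
  (if j \in J then s y else 1 - s y) * w (tnth t j) y.
have h_ge0 J t j y : 0 <= h J t j y.
  rewrite mulr_ge0//; have /andP[? _] := s01 y; have /andP[? _] := s'01 y.
  by case: ifP.
have mh J t j : measurable_fun setT (h J t j).
  apply: measurable_funM; first by rewrite /h; case: (j \in J).
  have [mp _ _] := hp (tnth t j).
  apply: measurable_funM; last exact: measurable_cst.
  by apply: measurable_funM => //; exact: measurable_cst.
have mprod J t : measurable_fun setT
    (fun x : m.-tuple 'rV[R]_d => \prod_(j < m) h J t j (tnth x j)).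
  apply: measurable_prod => j _; apply: measurableT_comp => //.
  exact: measurable_tnth.
pose G (x : m.-tuple 'rV[R]_d) :=
  \sum_(J : {set 'I_m} | #|J| == n) \sum_(t : m.-tuple 'I_M | uniq t)
    \prod_(j < m) h J t j (tnth x j).
have G_ge0 x : 0 <= G x.
  by do 2 (apply: sumr_ge0 => ? _); exact: prodr_ge0.
have mG : measurable_fun setT G.
  rewrite /G; under eq_fun do rewrite pair_big_dep/= -big_filter.
  by apply: measurable_sum => -[J t]; exact: mprod.
have mu0 x := lebesgue_rV_set1 R d x d_gt0.
have mdiag := measurable_rV_diag R d.
rewrite (@ge0_integral_null_ext _ _ _ _ [set x : m.-tuple 'rV[R]_d | ~~ uniq x] _
  (fun x => (P * G x)%:E)); first last.
- move=> x /negP/negPn ux; congr EFin; exact: mb_integrand_uniq.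
- by move=> x; rewrite lee_fin mulr_ge0.
- by move=> x; rewrite lee_fin mulr_ge0 ?fov_card_cond_ge0 ?mb_density_ge0.
- by apply/measurable_EFinP; apply: measurable_funM => //; exact: measurable_cst.
- by apply: tuple_measure_not_uniq => //; exact: measurable_rV_set1.
- rewrite (_ : mkset _ = ~` [set x : m.-tuple 'rV[R]_d | uniq x]).
    by apply: measurableC; exact: measurable_uniq_tuple.
  by apply/seteqP; split => x /= /negP.
under eq_integral do rewrite EFinM.
rewrite ge0_integralZl//; last 2 first.
- exact/measurable_EFinP.
- by move=> x _; rewrite lee_fin.
rewrite EFinM; congr (_ * _)%E.
(* The right side is expanded back into a sum over pairs [(J, t)], so that the integrals are
   compared term by term. *)
rewrite -sum_uniq_tuple /G [in RHS]pair_big_dep/= -sumEFin -[RHS]big_filter.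
under eq_integral do rewrite pair_big_dep/= -big_filter -sumEFin.
rewrite ge0_integral_sum//; last 2 first.
- by move=> [J t]; apply/measurable_EFinP; exact: mprod.
- by move=> [J t] x _; rewrite lee_fin prodr_ge0.
apply: eq_bigr => -[J t] _ /=; rewrite ge0_integral_tuple_prod// -prodEFin.
apply: eq_bigr => j _; rewrite /h; case: ifP => _.
  exact: integral_inner_pdf.
exact: integral_inner_pdf.
Qed.

End multi_bernoulli.

(** * Summation over the total number of objects *)

Theorem proposition3 (R : realType) (d k : nat) (hd : (0 < d)%N)
    (Xp : 'M[R]_(k, d)) (S : set 'rV[R]_d)
    (S_compact : compact S) (S_sub : forall x, S x -> (x <= Xp)%MS)
    (M : nat) (hM : (0 < M)%N)
    (r : 'I_M -> R) (hr : forall i, 0 <= r i < 1)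
    (p : 'I_M -> 'rV[R]_d -> R) (hp : forall i, is_pdf (p i))
    (f : {fset 'rV[R]_d} -> R) (hf : is_mb_density r p f) (n : nat) :
  fov_card_dist Xp S f n =
  ((\prod_(i < M) (1 - r i)) *
   \sum_(I : {set 'I_M} * {set 'I_M} * {set 'I_M} |
           [&& [disjoint I.1.1 & I.1.2], [disjoint I.1.1 & I.2],
               [disjoint I.1.2 & I.2] &
               I.1.1 :|: I.1.2 :|: I.2 == [set: 'I_M]%SET])
      ((n == #|I.1.1|)%:R *
       (\prod_(i in I.1.1)
          (inner (fov_indic Xp S) (fun x => r i * p i x) / (1 - r i))) *
       (\prod_(i in I.1.2)
          (inner (fun x => 1 - fov_indic Xp S x) (fun x => r i * p i x) /
           (1 - r i)))))%:E.
Proof.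
rewrite (sum_disjoint_triples R M
  (fun i => inner (fov_indic Xp S) (fun x => r i * p i x) / (1 - r i))
  (fun i => inner (fun x => 1 - fov_indic Xp S x) (fun x => r i * p i x) /
            (1 - r i))).
set W := card_weight R M _ _ n; set P := \prod_(i < M) _.
rewrite /fov_card_dist.
have term m : ((m`!%:R^-1 : R)%:E *
    \int[tuple_measure (lebesgue_rV R d) m]_x
      (fov_card_cond Xp S n [fset y | y in tval x]%fset *
       f [fset y | y in tval x]%fset)%:E)%E =
    (P * \sum_(U : {set 'I_M} | #|U| == m) W U)%:E.
  rewrite (integral_mb_summand _ _ _ _ _ _ _ _ _ hd S_compact hr hp hf) -EFinM.
  by rewrite mulrCA -[X in _ * (_ * X)]mulr_natl mulKf// pnatr_eq0 -lt0n fact_gt0.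
(* The split is at [n + M.+1], counted from the starting index [n]: every later [m] exceeds [M], and
   no index set has that many elements. *)
rewrite (nneseries_split _ M.+1) => [|m _]; last first.
  rewrite mule_ge0 ?lee_fin ?invr_ge0// integral_ge0// => x _.
  by rewrite lee_fin mulr_ge0 ?fov_card_cond_ge0 ?(mb_density_ge0 _ _ _ _ _ _ hr hp hf).
rewrite eseries0 ?adde0 => [|m + _]; last first.
  move=> nMm; rewrite term big1 ?mulr0// => U /eqP Um.
  have := max_card (mem U); rewrite Um card_ord => mM.
  by have := leq_trans nMm mM; rewrite addnS ltnNge leq_addl.
under eq_bigr do rewrite term.
rewrite sumEFin -mulr_sumr; congr (_ * _)%:E.
(* Each [U] occurs only at [m = #|U|]; this index is in the range unless [#|U| < n], and then [W U]
   vanishes because [U] has no subset of size [n]. *)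
rewrite (exchange_big_dep xpredT)//=; apply: eq_bigr => U _.
have [nU|Un] := leqP n #|U|.
  under eq_bigl do rewrite eq_sym.
  rewrite big_nat1_eq nU addnS ltnS (leq_trans _ (leq_addl _ _))//.
  by rewrite -[leqRHS]card_ord max_card.
suff -> : W U = 0 by rewrite big1.
rewrite /W /card_weight big1// => I /andP[/subset_leq_card IU /eqP In].
by rewrite In leqNgt Un in IU.
Qed.
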